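(* Let $k\ge 1$ and $d\ge 0$ be integers. Let $\mathcal{B}_d=\{m_1,m_2,\dots,m_N\}$ be the basis of $\mathcal{P}_k^d$ consisting of all monomials of degree $d$ in $x_1,\dots,x_k$. This basis induces an isomorphism $\phi:\mathcal{P}_k^d\to\mathbb{F}_2^N$, where a polynomial $f$ is mapped to its coordinate vector $[f]:=\phi(f)$ with respect to $\mathcal{B}_d$. Let $$\mathcal{H}_d(\mathcal{P}_k)=\{\,Sq^i(g)\;\mid\; i>0,\ g \text{ a monomial of degree } d-i \text{ in } \mathcal{P}_k\,\},$$ a generating set for the $\mathbb{F}_2$-subspace $(\mathcal{A}^+\mathcal{P}_k)_d$ of hit polynomials of degree $d$. Let $M$ be the matrix over $\mathbb{F}_2$ with $N$ rows whose columns are the coordinate vectors $[h]$ for the generators $h\in\mathcal{H}_d(\mathcal{P}_k)$. Then a polynomial $f\in\mathcal{P}_k^d$ is a hit polynomial if and only if the linear system $M\mathbf{c}=[f]$ has a solution for the coefficient vector $\mathbf{c}$ (with entries in $\mathbb{F}_2$).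
   Context: $\mathcal{P}_k=\mathbb{F}_2[x_1,\dots,x_k]$ is the polynomial algebra in $k$ variables, each of degree $1$, over the field $\mathbb{F}_2$, graded by degree; $\mathcal{P}_k^d$ is the $\mathbb{F}_2$-vector space of homogeneous polynomials of degree $d$ in $\mathcal{P}_k$ (together with $0$). The mod-2 Steenrod algebra $\mathcal{A}$ is generated by the Steenrod squares $Sq^i$, $i\ge 0$, and acts on $\mathcal{P}_k$ in the standard way: $Sq^i$ is $\mathbb{F}_2$-linear and raises degree by $i$; $Sq^0$ is the identity; $Sq^1(x_j)=x_j^2$ and $Sq^i(x_j)=0$ for $i>1$; $Sq^i(1)=0$ for $i>0$; and the Cartan formula $Sq^n(fg)=\sum_{i+j=n}Sq^i(f)Sq^j(g)$ holds. $\mathcal{A}^+$ denotes the augmentation ideal of $\mathcal{A}$. A polynomial $f\in\mathcal{P}_k^d$ is hit if it lies in $\mathcal{A}^+\mathcal{P}_k$, i.e. if it can be written as a finite sum $f=\sum_{i>0}Sq^i(g_i)$ with $g_i\in\mathcal{P}_k^{d-i}$. The set of all hit polynomials of degree $d$ is a vector subspace of $\mathcal{P}_k^d$, denoted $(\mathcal{A}^+\mathcal{P}_k)_d$. *)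

(* Defs.v *)
From HB Require Import structures.
From mathcomp Require Import all_boot all_order all_algebra.
From mathcomp.multinomials Require Import mpoly.

Set Implicit Arguments.
Unset Strict Implicit.
Unset Printing Implicit Defensive.

Import GRing.Theory.
Local Open Scope ring_scope.

(* The standard action of the Steenrod squares on F_2[x_1, ..., x_k].  The record has exactly
   one inhabitant up to pointwise equality: see steenrod_total and
   steenrod_action_unique below. *)
Record steenrod_action (k : nat) := SteenrodAction {
  Sq :> nat -> {linear {mpoly 'F_2[k]} -> {mpoly 'F_2[k]}};
  Sq_homog : forall (i d : nat) (f : {mpoly 'F_2[k]}),
    f \is d.-homog -> Sq i f \is (d + i).-homog;
  Sq0 : forall f : {mpoly 'F_2[k]}, Sq 0%N f = f;
  Sq1_var : forall j : 'I_k, Sq 1%N 'X_j = 'X_j ^+ 2;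
  Sq_var_gt1 : forall (i : nat) (j : 'I_k), (1 < i)%N -> Sq i 'X_j = 0;
  Sq_one : forall i : nat, (0 < i)%N -> Sq i 1 = 0;
  Sq_cartan : forall (n : nat) (f g : {mpoly 'F_2[k]}),
    Sq n (f * g) = \sum_(i < n.+1) Sq i f * Sq (n - i)%N g
}.

(* The summation stops at i = d because the graded piece of degree d - i is
   zero for i > d. *)
Definition hit (k : nat) (Sq : steenrod_action k) (d : nat) (f : {mpoly 'F_2[k]}) : Prop :=
  exists g : nat -> {mpoly 'F_2[k]},
    (forall i : nat, (0 < i <= d)%N -> g i \is (d - i).-homog) /\
    f = \sum_(1 <= i < d.+1) Sq i (g i).

Definition hit_generator (k : nat) (Sq : steenrod_action k) (d : nat)
    (h : {mpoly 'F_2[k]}) : Prop :=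
  exists (i : nat) (u : 'X_{1..k}),
    [/\ (0 < i)%N, (mdeg u + i = d)%N & h = Sq i 'X_[u]].

Definition enumerates (T : eqType) (N : nat) (t : N.-tuple T)
    (P : T -> Prop) : Prop :=
  uniq t /\ forall x : T, x \in t <-> P x.

Definition coord_vec (k N : nat) (m : N.-tuple 'X_{1..k}) (f : {mpoly 'F_2[k]}) :
    'cV['F_2]_N :=
  \col_(a < N) f@_(tnth m a).

Definition gen_matrix (k N n : nat) (m : N.-tuple 'X_{1..k})
    (h : n.-tuple {mpoly 'F_2[k]}) : 'M['F_2]_(N, n) :=
  \matrix_(a < N, b < n) coord_vec m (tnth h b) a 0.

Lemma enumerates_seq (T : eqType) (s : seq T) (P : T -> Prop) :
  (forall x, x \in s <-> P x) ->
  exists (N : nat) (t : N.-tuple T), enumerates t P.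
Proof.
move=> sP; exists (size (undup s)), (in_tuple (undup s)).
by split=> [|x] /=; [exact: undup_uniq | rewrite mem_undup].
Qed.

Definition monomials (k d : nat) : seq 'X_{1..k} :=
  [seq bmnm u | u <- enum {: 'X_{1..k < d.+1}} & mdeg (bmnm u) == d].

Lemma mem_monomials (k d : nat) (u : 'X_{1..k}) :
  (u \in monomials k d) = (mdeg u == d).
Proof.
apply/mapP/eqP => [[v]|du].
  by rewrite mem_filter => /andP[/eqP dv _] ->.
have lt_ud : (mdeg u < d.+1)%N by rewrite du.
by exists (BMultinom lt_ud) => //; rewrite mem_filter /= mem_enum du eqxx.
Qed.

Lemma monomial_basis_exists (k d : nat) :
  exists (N : nat) (m : N.-tuple 'X_{1..k}),
    enumerates m (fun u => mdeg u = d).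
Proof.
apply: (@enumerates_seq _ (monomials k d)) => u.
by rewrite mem_monomials; split=> /eqP.
Qed.

Lemma hit_generators_exist (k : nat) (Sq : steenrod_action k) (d : nat) :
  exists (n : nat) (h : n.-tuple {mpoly 'F_2[k]}), enumerates h (hit_generator Sq d).
Proof.
apply: (@enumerates_seq _
  [seq Sq i 'X_[u] | i <- iota 1 d, u <- monomials k (d - i)]) => p.
split=> [/allpairsPdep[i [u []]]|[i [u [i0 dui ->]]]].
  rewrite mem_iota add1n ltnS mem_monomials => /andP[i0 id] /eqP du ->.
  by exists i, u; rewrite du subnK.
apply/allpairsPdep; exists i, u; split=> //.
  by rewrite mem_iota i0 add1n ltnS -dui leq_addl.
by rewrite mem_monomials -dui addnK.
Qed.

(* Total square: the ring morphism 'X_j |-> 'X_j + 'X_j ^+ 2 * t, whose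
   coefficient of t ^ i is Sq^i. *)
Section TotalSquare.

Variable k : nat.

Definition total_square : {mpoly 'F_2[k]} -> {poly {mpoly 'F_2[k]}} :=
  mmap (fun c : 'F_2 => (c%:MP)%:P)
       (fun j : 'I_k => ('X_j)%:P + ('X_j ^+ 2)%:P * 'X).

Let cst (c : 'F_2) : {poly {mpoly 'F_2[k]}} := (c%:MP)%:P.

Let cst_is_additive : zmod_morphism cst.
Proof. by move=> a b; rewrite /cst !raddfB. Qed.

Let cst_is_multiplicative : monoid_morphism cst.
Proof. by split=> [|a b]; rewrite /cst ?rmorph1 ?rmorphM. Qed.

HB.instance Definition _ :=
  GRing.isZmodMorphism.Build 'F_2 {poly {mpoly 'F_2[k]}} cst cst_is_additive.
HB.instance Definition _ :=
  GRing.isMonoidMorphism.Build 'F_2 {poly {mpoly 'F_2[k]}} cst cst_is_multiplicative.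

Let vars (j : 'I_k) : {poly {mpoly 'F_2[k]}} := ('X_j)%:P + ('X_j ^+ 2)%:P * 'X.

Let total_squareE : total_square = mmap cst vars. Proof. by []. Qed.

Let total_squareM f g : total_square (f * g) = total_square f * total_square g.
Proof. by rewrite total_squareE rmorphM. Qed.

Let total_square1 : total_square 1 = 1.
Proof. by rewrite total_squareE rmorph1. Qed.

Let total_squareX j : total_square 'X_j = vars j.
Proof. by rewrite total_squareE mmapX mmap1U. Qed.

Definition coef_square (i : nat) (f : {mpoly 'F_2[k]}) : {mpoly 'F_2[k]} := (total_square f)`_i.

Fact coef_square_is_linear i : linear (coef_square i).
Proof.
move=> c f g; rewrite /coef_square total_squareE mmapD mmapZ coefD coefCM.
by rewrite mul_mpolyC.
Qed.

HB.instance Definition _ i :=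
  GRing.isLinear.Build 'F_2 {mpoly 'F_2[k]} {mpoly 'F_2[k]} _ (coef_square i)
    (coef_square_is_linear i).

Let coef_cartan n f g :
  coef_square n (f * g) =
  \sum_(i < n.+1) coef_square i f * coef_square (n - i)%N g.
Proof. by rewrite /coef_square total_squareM coefM. Qed.

Let coef_one i : coef_square i 1 = (i == 0%N)%:R.
Proof. by rewrite /coef_square total_square1 coef1. Qed.

Let coef_var i j :
  coef_square i 'X_j =
  if i == 0%N then 'X_j else if i == 1%N then 'X_j ^+ 2 else 0.
Proof.
rewrite /coef_square total_squareX /vars coefD coefC coefCM coefX.
by case: i => [|[|i]] /=; rewrite ?mulr0 ?mulr1 ?addr0 ?add0r.
Qed.

Lemma mpoly_monomial_ind (P : 'X_{1..k} -> Prop) :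
  P 0%MM -> (forall j u, P u -> P (U_(j) + u)%MM) -> forall u, P u.
Proof.
move=> P0 PS u; move: {2}(mdeg u) (erefl (mdeg u)) => n.
elim: n u => [|n IH] u du.
  by move/eqP: du; rewrite mdeg_eq0 => /eqP->.
have [j uj] : exists j, (0 < u j)%N.
  apply/existsP; rewrite -[[exists _, _]]negbK negb_exists.
  apply/negP => /forallP u0; move: du; rewrite mdegE big1 // => j _.
  by apply/eqP; rewrite -leqn0 leqNgt.
have leu : (U_(j) <= u)%MM.
  apply/mnm_lepP => l; rewrite mnm1E; case: eqP => // <- //.
rewrite -(submK leu) addmC; apply: PS; apply: IH.
by move: du; rewrite -{1}(submK leu) mdegD mdeg1 addn1 => -[].
Qed.

Let coef_homog i d (f : {mpoly 'F_2[k]}) :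
  f \is d.-homog -> coef_square i f \is (d + i).-homog.
Proof.
move=> hf; rewrite [f]mpolyE linear_sum /= big_seq; apply: rpred_sum => u uf.
rewrite linearZ /=; apply: rpredZ.
have <- : mdeg u = d by move/dhomogP: hf; apply.
elim/mpoly_monomial_ind: u {uf} i => [|j u IH] i.
  rewrite mpolyX0 coef_one mdeg0 add0n.
  by case: i => [|i] /=; rewrite ?dhomog1 ?dhomog0.
rewrite mpolyXD coef_cartan mdegD mdeg1; apply: rpred_sum => l _.
have -> : (1 + mdeg u + i = (1 + l) + (mdeg u + (i - l)))%N.
  by rewrite addnACA subnKC // -ltnS.
apply: dhomogM (IH _); rewrite coef_var.
case: eqP => [->|_]; first by rewrite dhomogX /= mdeg1.
case: eqP => [->|_]; last exact: dhomog0.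
have hX : ('X_j : {mpoly 'F_2[k]}) \is 1.-homog.
  by rewrite dhomogX /= mdeg1.
exact: (dhomogMn 2 hX).
Qed.

Let coef0_id (f : {mpoly 'F_2[k]}) : coef_square 0 f = f.
Proof.
rewrite {2}[f]mpolyE [f in LHS]mpolyE linear_sum /=; apply: eq_bigr => u _.
rewrite linearZ /=; congr (_ *: _).
elim/mpoly_monomial_ind: u => [|j u IH]; first by rewrite mpolyX0 coef_one.
by rewrite mpolyXD coef_cartan big_ord1 subnn IH coef_var.
Qed.

Let coef_var1 j : coef_square 1 'X_j = 'X_j ^+ 2.
Proof. by rewrite coef_var. Qed.

Let coef_var_gt1 i j : (1 < i)%N -> coef_square i 'X_j = 0.
Proof. by rewrite coef_var; case: i => [|[|i]]. Qed.

Let coef_one_gt0 i : (0 < i)%N -> coef_square i 1 = 0.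
Proof. by rewrite coef_one; case: i. Qed.

Definition steenrod_total : steenrod_action k :=
  @SteenrodAction k (fun i => coef_square i : {linear {mpoly 'F_2[k]} -> {mpoly 'F_2[k]}})
    coef_homog coef0_id coef_var1 coef_var_gt1 coef_one_gt0 coef_cartan.

Lemma steenrod_action_unique (S T : steenrod_action k) (i : nat) (f : {mpoly 'F_2[k]}) :
  S i f = T i f.
Proof.
rewrite [f]mpolyE !linear_sum /=; apply: eq_bigr => u _.
rewrite !linearZ /=; congr (_ *: _).
elim/mpoly_monomial_ind: u i => [|j u IH] i.
  by rewrite mpolyX0; case: i => [|i]; rewrite ?Sq0 ?Sq_one.
rewrite mpolyXD !Sq_cartan; apply: eq_bigr => l _; rewrite IH; congr (_ * _).
by case: (nat_of_ord l) => [|[|n]]; rewrite ?Sq0 ?Sq1_var ?Sq_var_gt1.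
Qed.

End TotalSquare.

(* Main.v *)
Require Import Defs.
From mathcomp Require Import all_boot all_order all_algebra.
From mathcomp.multinomials Require Import mpoly.

Set Implicit Arguments.
Unset Strict Implicit.

Import GRing.Theory.
Local Open Scope ring_scope.

(** The product of [gen_matrix m h] with [c] is the coordinate vector of the combination of
    generators with coefficients [c], and coordinates determine a polynomial homogeneous of degree
    [d]. So the system is solvable exactly when [f] lies in the span of the generators. This span is
    the space of hit polynomials: generators are hit and hit polynomials form a subspace
    ([hit_generator_hit], [hit_sum], [hitZ]); conversely, [hit_lin_comb] expands each [g i] into
    monomials. *)

Lemma gen_matrix_mulmx (k N n : nat) (m : N.-tuple 'X_{1..k})
    (h : n.-tuple {mpoly 'F_2[k]}) (c : 'cV['F_2]_n) :
  gen_matrix m h *m c = coord_vec m (\sum_b c b 0 *: tnth h b).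
Proof.
apply/matrixP => a j; rewrite (ord1 j) !mxE raddf_sum.
by apply: eq_bigr => b _; rewrite /= !mxE mcoeffZ mulrC.
Qed.

(** Coefficients at monomials of degree [d] are read off the vector, since [m] lists all of them;
    the others vanish by homogeneity. *)
Lemma coord_vec_inj (k d N : nat) (m : N.-tuple 'X_{1..k}) :
  enumerates m (fun u : 'X_{1..k} => mdeg u = d) ->
  {in d.-homog &, injective (coord_vec m)}.
Proof.
move=> [_ mP] f g hf hg /matrixP fg; apply/mpolyP => u.
have [/mP/tnthP[a ->]|/eqP du] := mdeg u =P d.
  by have := fg a 0; rewrite !mxE.
by rewrite (dhomog_nemf_coeff hf du) (dhomog_nemf_coeff hg du).
Qed.

Section Hit.

Variables (k d : nat) (Sq : steenrod_action k).

Lemma hit_sum (I : finType) (F : I -> {mpoly 'F_2[k]}) :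
  (forall b, hit Sq d (F b)) -> hit Sq d (\sum_b F b).
Proof.
move=> hF; elim/big_ind: _ => // [|f f' [g [hg ->]] [g' [hg' ->]]].
  exists (fun=> 0); split=> [i _|]; first exact: dhomog0.
  by rewrite big1 // => i _; rewrite linear0.
exists (fun i => g i + g' i); split=> [i id|].
  by rewrite rpredD ?hg ?hg'.
by rewrite -big_split; apply: eq_bigr => i _; rewrite linearD.
Qed.

Lemma hitZ (a : 'F_2) (f : {mpoly 'F_2[k]}) : hit Sq d f -> hit Sq d (a *: f).
Proof.
move=> [g [hg ->]]; exists (fun i => a *: g i); split=> [i id|].
  by rewrite rpredZ ?hg.
by rewrite scaler_sumr; apply: eq_bigr => i _; rewrite linearZ.
Qed.

Lemma hit_generator_hit (p : {mpoly 'F_2[k]}) :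
  hit_generator Sq d p -> hit Sq d p.
Proof.
(* The witness family is concentrated at the single index [i], which satisfies [i <= d] because
   [mdeg u + i = d]. *)
move=> [i [u [i0 dui ->]]]; exists (fun j => if j == i then 'X_[u] else 0).
split=> [j _|].
  by case: eqP => [->|_]; rewrite ?dhomog0 // dhomogX /= -dui addnK.
rewrite (bigD1_seq i) ?iota_uniq //=; last first.
  by rewrite mem_index_iota i0 ltnS -dui leq_addl.
by rewrite eqxx big1 ?addr0 // => j /negPf->; rewrite linear0.
Qed.

Lemma hit_generator_homog (p : {mpoly 'F_2[k]}) :
  hit_generator Sq d p -> p \is d.-homog.
Proof. by move=> [i [u [_ <- ->]]]; apply: Sq_homog; rewrite dhomogX. Qed.

Lemma hit_lin_comb (n : nat) (h : n.-tuple {mpoly 'F_2[k]})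
    (f : {mpoly 'F_2[k]}) :
  enumerates h (hit_generator Sq d) -> hit Sq d f ->
  exists c : 'cV['F_2]_n, f = \sum_b c b 0 *: tnth h b.
Proof.
(* [big_seq] keeps the range of [i] at hand: [g i] is known to be homogeneous only for
   [0 < i <= d]. *)
move=> [_ hP] [g [hg ->]]; rewrite big_seq.
pose spanned p := exists c : 'cV['F_2]_n, p = \sum_b c b 0 *: tnth h b.
have spanned0 : spanned 0.
  by exists 0; rewrite big1 // => b _; rewrite mxE scale0r.
have spannedD p q : spanned p -> spanned q -> spanned (p + q).
  move=> [c ->] [c' ->]; exists (c + c'); rewrite -big_split.
  by apply: eq_bigr => b _; rewrite mxE scalerDl.
apply: (big_ind spanned) => // i; rewrite mem_index_iota ltnS => id.
rewrite [g i]mpolyE linear_sum big_seq.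
apply: (big_ind spanned) => // u ug; rewrite linearZ /=.
(* A monomial in the support of [g i] has degree [d - i], so its image under [Sq i] is one of the
   listed generators. *)
have /tnthP[b ->] : Sq i 'X_[u] \in h.
  have /dhomogP/(_ u ug) du := hg i id; case/andP: id => i0 id.
  by apply/hP; exists i, u; rewrite i0 du subnK.
exists ((g i)@_u *: delta_mx b 0); rewrite (bigD1 b) //= big1.
  by rewrite !mxE !eqxx mulr1 addr0.
by move=> b' /negPf nb; rewrite !mxE nb mulr0 scale0r.
Qed.

End Hit.

Theorem theorem2p1 (k d : nat) (Sq : steenrod_action k)
    (N : nat) (m : N.-tuple 'X_{1..k})
    (n : nat) (h : n.-tuple {mpoly 'F_2[k]})
    (f : {mpoly 'F_2[k]}) :
  (1 <= k)%N ->
  enumerates m (fun u : 'X_{1..k} => mdeg u = d) ->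
  enumerates h (hit_generator Sq d) ->
  f \is d.-homog ->
  (hit Sq d f <-> exists c : 'cV['F_2]_n, gen_matrix m h *m c = coord_vec m f).
Proof.
move=> _ mP hP hf.
have gen b : hit_generator Sq d (tnth h b) by apply/hP.2/mem_tnth.
split=> [/(hit_lin_comb hP)[c ->]|[c]].
  by exists c; rewrite gen_matrix_mulmx.
rewrite gen_matrix_mulmx => /(coord_vec_inj mP) <- //.
  by apply: hit_sum => b; apply/hitZ/hit_generator_hit.
(* Injectivity of coordinates also requires the combination to be homogeneous of degree [d], as
   every generator is. *)
by apply: rpred_sum => b _; apply/rpredZ/hit_generator_homog.
Qed.
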